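(* Let $X=(x_1,\ldots,x_n)$ be a point configuration in $\mathbb{R}^d$ with weights $w=(w_1,\ldots,w_n)$, $w_i\ge 0$, $w_1+\cdots+w_n=1$, and fix a maximal regular triangulation $\Delta$ of $X$. Then the critical equations $\partial S_\Delta/\partial y_i=0$, $i=1,\ldots,n$, can be written in the form $$\exp(y_1)=p_1(y_1,y_2,\ldots,y_n),\quad \exp(y_2)=p_2(y_1,y_2,\ldots,y_n),\quad\ldots,\quad \exp(y_n)=p_n(y_1,y_2,\ldots,y_n)$$ where $p_1,\ldots,p_n\in\mathbb{R}(y_1,\ldots,y_n)$. If $x_1,\ldots,x_n\in\mathbb{Q}^d$, then $p_1,\ldots,p_n\in\mathbb{Q}(y_1,\ldots,y_n)$.
   Context: Triangulations. A triangulation $\Delta$ of $X$ is a collection of $d$-simplices with vertices in $X$, whose union is $\operatorname{conv}(X)$ and which intersect only along lower dimensional faces. Each simplex $\sigma$ is identified with the set of the $d+1$ indices of its vertices, and $\operatorname{vol}(\sigma)$ is its volume. $\Delta$ is maximal if every element of $X$ is a vertex of a simplex in $\Delta$. $\Delta$ is regular if its simplices are the regions of linearity of a tent function $h_{X,y}$ for some $y\in\mathbb{R}^n$, where $h_{X,y}$ is the smallest concave function on $\mathbb{R}^d$ with $h_{X,y}(x_i)\ge y_i$ for all $i$. Objective function. For such $\Delta$, $$S_\Delta(y_1,\ldots,y_n)=w\cdot y-\sum_{\sigma\in\Delta}\sum_{i\in\sigma}\frac{\operatorname{vol}(\sigma)\exp(y_i)}{\prod_{\alpha\in\sigma\setminus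 i}(y_i-y_\alpha)}.$$ Critical equations. The equations $\partial S_\Delta/\partial y_i=0$ ($i=1,\ldots,n$) take the form $A e^y=w$, where $e^y=(e^{y_1},\ldots,e^{y_n})^T$, $w$ is viewed as a column vector, and $A$ (the score equation matrix) is the $n\times n$ matrix over the field of rational functions in $y_1,\ldots,y_n$ with $$A_{j,j}=\sum_{\sigma\in\Delta,\ j\in\sigma}\operatorname{vol}(\sigma)\frac{1}{\prod_{\alpha\in\sigma\setminus j}(y_j-y_\alpha)}\Bigl(1-\sum_{\alpha\in\sigma\setminus j}\frac{1}{y_j-y_\alpha}\Bigr),$$ $$A_{i,j}=\sum_{\sigma\in\Delta,\ i,j\in\sigma}\operatorname{vol}(\sigma)\frac{1}{\prod_{\alpha\in\sigma\setminus j}(y_j-y_\alpha)}\cdot\frac{1}{y_j-y_i}\qquad(i\ne j).$$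
   Formalization: The claim that rational points give p_i in Q(y) is proved for rational weights w, since it fails for irrational weights (w is A times p); for arbitrary weights it is proved that each p_i is a combination of the w_j with coefficients in Q(y). *)

(* Defs.v *)
From HB Require Import structures.
From mathcomp Require Import all_boot all_order all_algebra.
From mathcomp Require Import all_classical all_reals.
From mathcomp Require Import topology normedtype sequences derive exp convex.
(* The notations of mpoly clash with those of mathcomp-analysis: the ring of
   polynomials over R in n indeterminates is written [mpoly n R]. *)
From mathcomp Require mpoly.
Import -(notations) mpoly.

Set Implicit Arguments.
Unset Strict Implicit.
Unset Printing Implicit Defensive.

Import Order.TTheory GRing.Theory Num.Theory.
Import numFieldNormedType.Exports.

Local Open Scope classical_set_scope.
Local Open Scope ring_scope.

Section PointConfigurations.
Variables (R : realType) (n d : nat) (x : 'I_n -> 'rV[R]_d).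

Definition hull (sigma : {set 'I_n}) : set 'rV[R]_d :=
  [set z | exists c : 'I_n -> R,
    [/\ forall i, i \in sigma -> 0 <= c i,
        \sum_(i in sigma) c i = 1 &
        z = \sum_(i in sigma) c i *: x i]].

Definition affinely_independent (sigma : {set 'I_n}) : Prop :=
  forall c : 'I_n -> R,
    \sum_(i in sigma) c i = 0 -> \sum_(i in sigma) c i *: x i = 0 ->
    forall i, i \in sigma -> c i = 0.

Definition full_simplex (sigma : {set 'I_n}) : Prop :=
  #|sigma| = d.+1 /\ affinely_independent sigma.

(* |det| / d! of the square matrix with rows (1, x_i), i \in sigma.  The matrix
   has #|sigma| rows; [conform_mx] casts it to size 1 + d when
   #|sigma| = d.+1, the only case in which [vol] is used. *)
Definition vol (sigma : {set 'I_n}) : R :=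
  `| \det (conform_mx (0 : 'M[R]_(1 + d))
       (row_mx (const_mx 1 : 'cV_#|sigma|)
               (\matrix_(k < #|sigma|) x (enum_val k)))) |
  / (d`!)%:R.

Definition triangulation (Delta : {set {set 'I_n}}) : Prop :=
  [/\ forall sigma, sigma \in Delta -> full_simplex sigma,
      \bigcup_(sigma in [set` Delta]) hull sigma = hull [set: 'I_n] &
      forall sigma tau, sigma \in Delta -> tau \in Delta -> sigma != tau ->
        hull sigma `&` hull tau = hull (sigma :&: tau)%SET].

Definition maximal_triangulation (Delta : {set {set 'I_n}}) : Prop :=
  forall i : 'I_n, exists2 sigma, sigma \in Delta & i \in sigma.

(* Concavity of a function that may take infinite values; in the extended
   reals of mathcomp-analysis +oo + -oo = -oo, so the inequality is void as
   soon as h u = -oo or h v = -oo. *)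
Definition concave (h : 'rV[R]_d -> \bar R) : Prop :=
  forall (t : R) (u v : 'rV[R]_d), 0 < t -> t < 1 ->
    (t%:E * h u + (1 - t)%:E * h v <= h (t *: u + (1 - t) *: v)%R)%E.

(* h is the tent function h_{X,y}: it is -oo outside conv(X). *)
Definition is_tent_function (y : 'I_n -> R) (h : 'rV[R]_d -> \bar R) : Prop :=
  [/\ concave h,
      forall i, ((y i)%:E <= h (x i))%E &
      forall g : 'rV[R]_d -> \bar R, concave g ->
        (forall i, ((y i)%:E <= g (x i))%E) -> forall z, (h z <= g z)%E].

Definition affine_on (C : set 'rV[R]_d) (h : 'rV[R]_d -> \bar R) : Prop :=
  exists (a : 'cV[R]_d) (b : R),
    forall z, C z -> h z = ((z *m a) 0 0 + b)%:E.

Definition region_of_linearity (h : 'rV[R]_d -> \bar R)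
    (C : set 'rV[R]_d) : Prop :=
  [/\ convex_set (C : set (convex_lmodType 'rV[R]_d)), affine_on C h &
      forall C' : set 'rV[R]_d,
        convex_set (C' : set (convex_lmodType 'rV[R]_d)) -> affine_on C' h ->
        C `<=` C' -> C' = C].

Definition regular_triangulation (Delta : {set {set 'I_n}}) : Prop :=
  exists (y : 'I_n -> R) (h : 'rV[R]_d -> \bar R),
    is_tent_function y h /\
    forall C : set 'rV[R]_d,
      region_of_linearity h C <->
      exists2 sigma, sigma \in Delta & C = hull sigma.

Definition objective (w : 'I_n -> R) (Delta : {set {set 'I_n}})
    (y : 'rV[R]_n) : R :=
  \sum_i w i * y 0 i -
  \sum_(sigma in Delta) \sum_(i in sigma)
    vol sigma * expR (y 0 i) /
      \prod_(alpha in (sigma :\ i)%SET) (y 0 i - y 0 alpha).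

Definition objective_domain (Delta : {set {set 'I_n}}) : set 'rV[R]_n :=
  [set y | forall sigma, sigma \in Delta ->
    forall i j, i \in sigma -> j \in sigma -> i != j -> y 0 i != y 0 j].

Definition rational_configuration : Prop :=
  forall i k, exists q : rat, x i 0 k = ratr q.

End PointConfigurations.

Definition partial (R : realType) (n : nat) (F : 'rV[R]_n -> R) (i : 'I_n) :
    'rV[R]_n -> R :=
  fun y => 'D_(delta_mx 0 i) F y.

Section RationalFunctions.
Variables (R : realType) (n : nat).

Definition ratfun := {fraction (mpoly n R)}.

Definition mpoly_at (P : mpoly n R) (y : 'rV[R]_n) : R :=
  meval (fun i => y 0 i) P.

Definition ratfun_value (p : ratfun) (y : 'rV[R]_n) (v : R) : Prop :=
  exists P Q : mpoly n R,
    [/\ mpoly_at Q y != 0, p = tofrac P / tofrac Q &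
        v = mpoly_at P y / mpoly_at Q y].

Definition regular_at (p : ratfun) (y : 'rV[R]_n) : Prop :=
  exists v, ratfun_value p y v.

(* Meaningful at the points where p is regular, where [ratfun_value p y] is a
   singleton. *)
Definition ratfun_at (p : ratfun) (y : 'rV[R]_n) : R :=
  xget 0 (ratfun_value p y).

(* p lies in the subfield Q(y_1, ..., y_n) of R(y_1, ..., y_n). *)
Definition over_rat (p : ratfun) : Prop :=
  exists P Q : mpoly n rat,
    Q != 0 /\
    p = tofrac (map_mpoly (@ratr R) P) / tofrac (map_mpoly (@ratr R) Q).

Definition ratfun_const (c : R) : ratfun := tofrac (mpolyC n c).

(* On [dom], the system of equations F_j(y) = 0 can be written in the form
   exp(y_i) = p_i(y).  Rational functions are only defined generically, so this
   is an identity over the field R(y): the vector (exp(y_i) - p_i)_i is the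
   image of (F_j)_j under an invertible matrix B of rational functions.
   Mere equality of the real solution sets would be too weak: when the system
   has a unique solution y*, it would hold for the constants
   p_i := exp(y*_i). *)
Definition can_be_written_as_exp (dom : set 'rV[R]_n)
    (F : 'I_n -> 'rV[R]_n -> R) (p : 'I_n -> ratfun) : Prop :=
  exists B : 'M[ratfun]_n,
    B \in unitmx /\
    forall y, dom y -> (forall i j, regular_at (B i j) y) ->
      [/\ forall i, regular_at (p i) y,
          forall i, expR (y 0 i) - ratfun_at (p i) y =
                    \sum_j ratfun_at (B i j) y * F j y &
          (forall j, F j y = 0) <->
          (forall i, expR (y 0 i) = ratfun_at (p i) y)].

End RationalFunctions.

(* Main.v *)
Require Import Defs.
From HB Require Import structures.
From mathcomp Require Import all_boot all_order all_algebra.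
From mathcomp Require Import all_classical all_reals.
From mathcomp Require Import topology normedtype sequences derive.
From mathcomp Require Import realfun exp convex.
From mathcomp Require Import ring.
From mathcomp Require mpoly.
Import -(notations) mpoly.

Set Implicit Arguments.
Unset Strict Implicit.
Unset Printing Implicit Defensive.

Import Order.TTheory GRing.Theory Num.Theory.
Import numFieldNormedType.Exports.
Local Open Scope ring_scope.

(** Differentiating the objective shows that, away from the coincidences of
    coordinates inside a simplex, the j-th critical function at y is
    [w j - \sum_i A j i * expR (y i)], where A is the score matrix; it is a
    matrix of rational functions, with coefficients built from the volumes of
    the simplices. Once A is known to be invertible over the field of rational
    functions, [B := - invmx A] and [p := invmx A *m w] do what is asked:
    [B *m (w - A *m e) = e - invmx A *m w]. These identities between rational
    functions survive evaluation at a point where B is regular, since A is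
    regular on the whole domain of the objective; there B also has an
    invertible value, because [A *m B = - 1%:M] survives too. If the points are
    rational then so are the volumes, hence the entries of A and of its inverse.

    Invertibility of A is the heart of the matter. The entry (j, i) of A is the
    sum over the simplices sigma containing i of
    [vol sigma / \prod_(a in sigma :\ i) (y i - y a)] times
    [(i == j)%:R - \sum_(a in sigma :\ i)
       ((i == j)%:R - (a == j)%:R) / (y i - y a)].
    The first summand of the second factor has degree 0 in y, and the other ones
    have degree -1. So dividing y by s turns A into
    [s ^+ d *: (diag - s *: E)] with diag and E independent of s
    ([score_matrix_scaling]). The determinant of [diag - s *: E] is a polynomial
    in s with constant coefficient the product of the diagonal entries, hence it
    has a nonzero value as soon as none of these entries vanishes
    ([det_diag_perturbation]). The j-th one is
    [\sum_sigma vol sigma / \prod_(a in sigma :\ j) (y j - y a)], over the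
    simplices containing j. It is nonzero because at the point with coordinate
    1 at j and 0 elsewhere its value is the total volume of these simplices,
    which is positive: j belongs to some simplex by maximality, and simplices
    are nondegenerate ([score_diag_neq0]). Finally, a nonzero determinant after
    the substitution of y / s for y comes from a nonzero determinant
    ([det_score_neq0]). *)

(** * Partial morphisms between fields *)

Section PartialMorphisms.
Variables (K L : fieldType).
(** Evaluating a rational function at a point is a ring morphism defined only
    on the functions regular at that point. Encoding such a map by its graph, a
    subring of K * L closed under those inverses that exist in L, spares all
    definedness side conditions except the nonvanishing of denominators.
    Membership in a subfield of K is the case of the identity restricted to that
    subfield. *)
Definition partial_morphism (rel : K -> L -> Prop) : Prop :=
  [/\ rel 1 1,
      forall a b a' b', rel a a' -> rel b b' -> rel (a - b) (a' - b'),
      forall a b a' b', rel a a' -> rel b b' -> rel (a * b) (a' * b') &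
      forall a a', rel a a' -> a' != 0 -> rel a^-1 a'^-1].
Variable rel : K -> L -> Prop.
Hypothesis rel_pm : partial_morphism rel.

Lemma pmorph1 : rel 1 1. Proof. by case: rel_pm. Qed.

Lemma pmorphB a b a' b' : rel a a' -> rel b b' -> rel (a - b) (a' - b').
Proof. by case: rel_pm => _ + _ _; apply. Qed.

Lemma pmorphM a b a' b' : rel a a' -> rel b b' -> rel (a * b) (a' * b').
Proof. by case: rel_pm => _ _ + _; apply. Qed.

Lemma pmorphV a a' : rel a a' -> a' != 0 -> rel a^-1 a'^-1.
Proof. by case: rel_pm => _ _ _; apply. Qed.

Lemma pmorph0 : rel 0 0.
Proof.
by rewrite -(subrr 1) -[X in rel _ X](subrr 1); apply: pmorphB pmorph1 pmorph1.
Qed.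

Lemma pmorphN a a' : rel a a' -> rel (- a) (- a').
Proof.
by move=> aa'; rewrite -[- a]sub0r -[- a']sub0r; apply: pmorphB pmorph0 aa'.
Qed.

Lemma pmorphD a b a' b' : rel a a' -> rel b b' -> rel (a + b) (a' + b').
Proof.
by move=> aa' /pmorphN bb'; rewrite -[b]opprK -[b']opprK; apply: pmorphB.
Qed.

Lemma pmorph_nat k : rel k%:R k%:R.
Proof.
elim: k => [|k IHk]; first exact: pmorph0.
by rewrite -!natr1; apply: pmorphD IHk pmorph1.
Qed.

Lemma pmorph_sum (I : Type) (r : seq I) (P : pred I)
    (F : I -> K) (F' : I -> L) :
  (forall i, P i -> rel (F i) (F' i)) ->
  rel (\sum_(i <- r | P i) F i) (\sum_(i <- r | P i) F' i).
Proof.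
move=> FF'; elim/big_rec2: _ => [|i a a' Pi aa']; first exact: pmorph0.
exact: pmorphD (FF' i Pi) aa'.
Qed.

Lemma pmorph_prod (I : Type) (r : seq I) (P : pred I)
    (F : I -> K) (F' : I -> L) :
  (forall i, P i -> rel (F i) (F' i)) ->
  rel (\prod_(i <- r | P i) F i) (\prod_(i <- r | P i) F' i).
Proof.
move=> FF'; elim/big_rec2: _ => [|i a a' Pi aa']; first exact: pmorph1.
exact: pmorphM (FF' i Pi) aa'.
Qed.

Lemma pmorph_sign k : rel ((-1) ^+ k) ((-1) ^+ k).
Proof.
elim: k => [|k IHk]; first exact: pmorph1.
by rewrite !exprS; apply: pmorphM IHk; apply: pmorphN pmorph1.
Qed.

Lemma pmorph_det m (M : 'M[K]_m) (M' : 'M[L]_m) :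
  (forall i j, rel (M i j) (M' i j)) -> rel (\det M) (\det M').
Proof.
move=> MM'; apply: pmorph_sum => s _; apply: pmorphM; first exact: pmorph_sign.
by apply: pmorph_prod.
Qed.

End PartialMorphisms.

(** * Specialization of fractions *)

Lemma subf_div (F : fieldType) (a b c d : F) :
  b != 0 -> d != 0 -> a / b - c / d = (a * d - c * b) / (b * d).
Proof. by move=> b0 d0; rewrite -mulNr addf_div // mulNr. Qed.

Section Specialization.
Variables (D : idomainType) (L : fieldType) (phi : {rmorphism D -> L}).
Definition specializes (p : {fraction D}) (v : L) : Prop :=
  exists P Q : D, [/\ phi Q != 0, p = tofrac P / tofrac Q & v = phi P / phi Q].

Lemma specializes_tofrac P : specializes (tofrac P) (phi P).
Proof. by exists P, 1; rewrite !rmorph1 oner_eq0 !divr1. Qed.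

Let denom_neq0 (Q : D) : phi Q != 0 -> tofrac Q != 0.
Proof. by rewrite tofrac_eq0; apply: contraNneq => ->; rewrite rmorph0. Qed.

Lemma specializes_pm : partial_morphism specializes.
Proof.
split.
- by have := specializes_tofrac 1; rewrite !rmorph1.
- move=> _ _ _ _ [P [Q [Q0 -> ->]]] [P' [Q' [Q'0 -> ->]]].
  exists (P * Q' - P' * Q), (Q * Q'); split; first by rewrite rmorphM mulf_neq0.
    by rewrite subf_div ?denom_neq0 // rmorphB !rmorphM.
  by rewrite subf_div // rmorphB !rmorphM.
- move=> _ _ _ _ [P [Q [Q0 -> ->]]] [P' [Q' [Q'0 -> ->]]].
  exists (P * P'), (Q * Q'); split; first by rewrite rmorphM mulf_neq0.
    by rewrite !rmorphM /= mulf_div.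
  by rewrite !rmorphM mulf_div.
- move=> _ _ [P [Q [Q0 -> ->]]].
  rewrite mulf_eq0 invr_eq0 (negPf Q0) orbF => P0.
  by exists Q, P; rewrite !invf_div.
Qed.

Lemma specializes_unique p v v' : specializes p v -> specializes p v' -> v = v'.
Proof.
move=> [P [Q [Q0 -> ->]]] [P' [Q' [Q'0 eqp ->]]].
apply/eqP; rewrite eqr_div // -!rmorphM; apply/eqP; congr (phi _).
apply/eqP; rewrite -tofrac_eq !rmorphM /= -eqr_div ?denom_neq0 //; exact/eqP.
Qed.

End Specialization.

(** * The score matrix and its behaviour under scaling *)

Section ScoreMatrix.
Variables (n : nat) (Delta : {set {set 'I_n}}).
Definition lagrange_denom (K : fieldType) (y : 'I_n -> K)
    (sigma : {set 'I_n}) (i : 'I_n) : K :=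
  \prod_(alpha in (sigma :\ i)%SET) (y i - y alpha).

(** The entry (j, i) is the coefficient of exp(y_i) in the derivative with
    respect to y_j of the sum over the simplices. The Kronecker symbols merge
    the diagonal and the off-diagonal formulas: for i != j only a = j
    contributes to the inner sum, so that a simplex avoiding j adds 0. *)
Definition score_matrix (K : fieldType) (v : {set 'I_n} -> K)
    (y : 'I_n -> K) : 'M[K]_n :=
  \matrix_(j, i) \sum_(sigma in Delta | i \in sigma)
    v sigma / lagrange_denom y sigma i *
    ((i == j)%:R - \sum_(alpha in (sigma :\ i)%SET)
                      ((i == j)%:R - (alpha == j)%:R) / (y i - y alpha)).

Definition injective_on_simplices (K : eqType) (y : 'I_n -> K) :=
  forall sigma, sigma \in Delta -> {in sigma &, injective y}.

(** The entries are field expressions whose denominators are differences of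
    coordinates inside one simplex, hence injectivity on the simplices of the
    target point is all that evaluating them requires. *)
Lemma pmorph_score (K L : fieldType) (rel : K -> L -> Prop)
    (v : {set 'I_n} -> K) (y : 'I_n -> K)
    (v' : {set 'I_n} -> L) (y' : 'I_n -> L) :
  partial_morphism rel ->
  (forall sigma, sigma \in Delta -> rel (v sigma) (v' sigma)) ->
  (forall i, rel (y i) (y' i)) ->
  injective_on_simplices y' ->
  forall j i, rel (score_matrix v y j i) (score_matrix v' y' j i).
Proof.
move=> relpm vv' yy' y'inj j i; rewrite !mxE.
apply: pmorph_sum => // sigma /andP[sD isg].
have dif alpha : alpha \in (sigma :\ i)%SET -> y' i - y' alpha != 0.
  rewrite !inE => /andP[ai asg]; rewrite subr_eq0; apply: contraNneq ai => e.
  by rewrite eq_sym; apply/eqP/(y'inj sigma).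
apply: pmorphM => //.
  apply: pmorphM; [by []|exact: vv'|].
  apply: pmorphV => //; last by apply/prodf_neq0.
  by apply: pmorph_prod => // alpha _; apply: pmorphB.
apply: pmorphB; [by []|exact: pmorph_nat|].
apply: pmorph_sum => // alpha /dif d; apply: pmorphM => //.
  by apply: pmorphB; [|exact: pmorph_nat|exact: pmorph_nat].
by apply: pmorphV d => //; apply: pmorphB.
Qed.

Definition score_diag (K : fieldType) (v : {set 'I_n} -> K)
    (y : 'I_n -> K) (j : 'I_n) : K :=
  \sum_(sigma in Delta | j \in sigma) v sigma / lagrange_denom y sigma j.

(** In the entry for i of a d-dimensional simplex, the denominator has d factors
    homogeneous of degree 1. The Kronecker symbol outside the inner sum is left
    alone and yields the diagonal; each term of the inner sum, also those with
    i = j, carries one further division by a difference, hence the factor s. *)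
Lemma score_matrix_scaling d (K : fieldType) (v : {set 'I_n} -> K)
    (y : 'I_n -> K) :
  (forall sigma, sigma \in Delta -> #|sigma| = d.+1) ->
  exists E : 'M[K]_n, forall s, s != 0 ->
    score_matrix v (fun i => s^-1 * y i) =
    s ^+ d *: (diag_mx (\row_j score_diag v y j) - s *: E).
Proof.
move=> card.
exists (\matrix_(j, i) \sum_(sigma in Delta | i \in sigma)
    v sigma / lagrange_denom y sigma i *
    \sum_(alpha in (sigma :\ i)%SET)
       ((i == j)%:R - (alpha == j)%:R) / (y i - y alpha)).
move=> s s0; apply/matrixP=> j i; rewrite !mxE.
have -> : score_diag v y j *+ (j == i) = score_diag v y i * (i == j)%:R.
  by rewrite eq_sym; case: eqVneq => [->|_]; rewrite ?mulr1 ?mulr0.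
rewrite mulr_suml [s * _]mulr_sumr -sumrB mulr_sumr.
apply: eq_bigr => sigma /andP[sD isg].
rewrite -mulrA [s * (_ * _)]mulrCA -mulrBr.
have -> : lagrange_denom (fun i => s^-1 * y i) sigma i =
    (s ^+ d)^-1 * lagrange_denom y sigma i.
  rewrite /lagrange_denom.
  rewrite (eq_bigr (fun alpha => s^-1 * (y i - y alpha))); last first.
    by move=> alpha _; rewrite mulrBr.
  rewrite big_split prodr_const /= exprVn; congr (_ ^- _ * _).
  by have := cardsD1 i sigma; rewrite isg card // => -[->].
rewrite invfM invrK -mulrA mulrCA; congr (_ * _).
rewrite mulrA; congr (_ * (_ - _)).
rewrite mulr_sumr; apply: eq_bigr => alpha _.
by rewrite -mulrBr invfM invrK mulrCA.
Qed.

End ScoreMatrix.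

(** * Invertibility of the score matrix *)

Lemma exists_nat_nonroot (K : fieldType) (p : {poly K}) :
  (forall k, k.+1%:R != 0 :> K) -> p != 0 ->
  exists k, p.[k.+1%:R] != 0.
Proof.
move=> nat_neq0 p0; apply: contrapT => noex.
have nat_inj : injective (fun k => k.+1%:R : K).
  move=> a b /=; wlog ab : a b / (a <= b)%N.
    by move=> W e; case: (leqP a b) => [/W->//|/ltnW /W->//].
  rewrite -(subnKC ab) -addSn natrD => /eqP.
  rewrite -{1}[a.+1%:R]addr0 (inj_eq (addrI _)) eq_sym.
  case: (b - a)%N => [|k]; first by rewrite addn0.
  by rewrite (negPf (nat_neq0 k)).
have := max_poly_roots p0 (rs := [seq k.+1%:R | k <- iota 0 (size p)]).
rewrite size_map size_iota ltnn => F; suff: false by []; apply: F.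
  apply/allP => _ /mapP[k _ ->]; rewrite /root.
  by apply/negPn/negP => pk; apply: noex; exists k.
by rewrite map_inj_uniq ?iota_uniq.
Qed.

(** The determinant is a polynomial in s whose value at 0 is the product of the
    [c j]; being nonzero, it has a nonroot among the positive integers. *)
Lemma det_diag_perturbation (K : fieldType) m (c : 'I_m -> K) (E : 'M[K]_m) :
  (forall k, k.+1%:R != 0 :> K) -> (forall j, c j != 0) ->
  exists2 s, s != 0 & \det (diag_mx (\row_j c j) - s *: E) != 0.
Proof.
move=> nat_neq0 c_neq0.
(* The matrix with s replaced by an indeterminate. *)
pose p : {poly K} := \det (diag_mx (\row_j (c j)%:P) - 'X *: map_mx polyC E).
have p_at s : p.[s] = \det (diag_mx (\row_j c j) - s *: E).
  rewrite -[LHS]/(horner_eval s p) -det_map_mx; congr (\det _).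
  apply/matrixP => i j; rewrite !mxE /= horner_evalE.
  by rewrite hornerD hornerN hornerM hornerX !hornerC hornerMn hornerC.
have [|k pk] := exists_nat_nonroot nat_neq0 (p := p).
  apply/eqP => p0; have := p_at 0.
  rewrite p0 horner0 scale0r subr0 det_diag => /esym/eqP/prodf_eq0[j _].
  by rewrite mxE (negPf (c_neq0 j)).
by exists k.+1%:R; rewrite -?p_at.
Qed.

Lemma det_score_scaled_neq0 (K : fieldType) n d (Delta : {set {set 'I_n}})
    (v : {set 'I_n} -> K) (y : 'I_n -> K) :
  (forall k, k.+1%:R != 0 :> K) ->
  (forall sigma, sigma \in Delta -> #|sigma| = d.+1) ->
  (forall j, score_diag Delta v y j != 0) ->
  exists2 s, s != 0 & \det (score_matrix Delta v (fun i => s^-1 * y i)) != 0.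
Proof.
move=> nat_neq0 card diag_neq0.
have [E scaling] := score_matrix_scaling v y card.
have [s s0 det_s] := det_diag_perturbation E nat_neq0 diag_neq0.
exists s; rewrite // scaling // detZ mulf_neq0 //.
by rewrite !expf_neq0.
Qed.

Definition var (R : realType) n (i : 'I_n) : ratfun R n :=
  tofrac (mpolyX R (mnm1 i)).

Lemma var_inj (R : realType) n : injective (@var R n).
Proof.
move=> i j /eqP; rewrite tofrac_eq => /eqP/(congr1 (mcoeff (mnm1 i))).
rewrite !mcoeffX eqxx eq_mnm1.
by case: eqVneq => //= _ /eqP; rewrite oner_eq0.
Qed.

Lemma natr_ratfun_neq0 (R : realType) n k : k.+1%:R != 0 :> ratfun R n.
Proof.
rewrite -(rmorph_nat (@tofrac _)) tofrac_eq0.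
rewrite -(rmorph_nat (@mpolyC n R)) mpolyC_eq0 pnatr_eq0 //.
Qed.

Section Det.
Variables (R : realType) (n d : nat) (Delta : {set {set 'I_n}}).
Variable v : {set 'I_n} -> R.
Hypothesis v_gt0 : forall sigma, sigma \in Delta -> 0 < v sigma.
Hypothesis card : forall sigma, sigma \in Delta -> #|sigma| = d.+1.
Hypothesis cover : maximal_triangulation Delta.
Let vK := ratfun_const n \o v.

(** At the point e with coordinate 1 at j and 0 elsewhere, all the differences
    [e j - e a] equal 1, so the value is a sum of positive volumes. A point
    depending on j is enough here since the entries are rational functions, for
    which nonvanishing at one point means nonvanishing as such. *)
Lemma score_diag_neq0 j : score_diag Delta vK (@var R n) j != 0.
Proof.
pose e : 'I_n -> R := fun i => (i == j)%:R.
have spm := specializes_pm (meval e).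
have denom sigma : lagrange_denom e sigma j = 1.
  by apply: big1 => a; rewrite !inE => /andP[/negPf aj _]; rewrite /e eqxx aj subr0.
have : specializes (meval e) (score_diag Delta vK (@var R n) j)
    (score_diag Delta v e j).
  apply: (pmorph_sum spm) => sigma _; apply: (pmorphM spm).
    by have := specializes_tofrac (meval e) (mpolyC n (v sigma)); rewrite /= mevalC.
  apply: (pmorphV spm); last by rewrite denom oner_eq0.
  apply: (pmorph_prod spm) => a _; apply: (pmorphB spm).
    by have := specializes_tofrac (meval e) (mpolyX R (mnm1 j)); rewrite /= mevalXU.
  by have := specializes_tofrac (meval e) (mpolyX R (mnm1 a)); rewrite /= mevalXU.
move=> sp; apply/eqP => s0; rewrite s0 in sp.
have := specializes_unique sp (pmorph0 spm).
apply/eqP; rewrite gt_eqF //.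
have [sigma sD js] := cover j.
rewrite /score_diag (bigD1 sigma) ?sD //= ltr_wpDr //.
  by apply: sumr_ge0 => tau /andP[/andP[tD _] _]; rewrite denom divr1 ltW ?v_gt0.
by rewrite denom divr1 v_gt0.
Qed.

(** The substitution of [s^-1 * y] for y is a specialization from the field of
    rational functions to itself, and after it the determinant is nonzero. *)
Lemma det_score_neq0 : \det (score_matrix Delta vK (@var R n)) != 0.
Proof.
have [s s0 det_s] :=
  det_score_scaled_neq0 (@natr_ratfun_neq0 R n) card score_diag_neq0.
pose y i := s^-1 * @var R n i.
have spm := specializes_pm (meval y \o map_mpoly (@tofrac _ \o @mpolyC n R)).
set phi := (X in specializes X) in spm.
have sp : specializes phi (\det (score_matrix Delta vK (@var R n)))
    (\det (score_matrix Delta vK y)).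
  apply: (pmorph_det spm) => j i; apply: (pmorph_score spm).
  - move=> sigma _; have := specializes_tofrac phi (mpolyC n (v sigma)).
    by rewrite /= map_mpolyC mevalC.
  - move=> k; have := specializes_tofrac phi (mpolyX R (mnm1 k)).
    by rewrite /= map_mpolyX mevalXU.
  - by move=> sigma _ a b _ _ /(mulfI (invr_neq0 s0))/var_inj.
apply: contraNneq det_s => det0; rewrite det0 in sp.
by rewrite (specializes_unique sp (pmorph0 spm)).
Qed.

End Det.

(** * Rational functions with rational coefficients *)

Section FractionsOverSubring.
Variables (D0 D : idomainType) (iota : {rmorphism D0 -> D}).
Hypothesis iota_inj : injective iota.
Definition fraction_over (p : {fraction D}) : Prop :=
  exists P Q : D0, Q != 0 /\ p = tofrac (iota P) / tofrac (iota Q).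

Lemma tofrac_iota_neq0 Q : Q != 0 -> tofrac (iota Q) != 0.
Proof. by rewrite tofrac_eq0 raddf_eq0. Qed.

Lemma fraction_over_pm :
  partial_morphism (fun p q => p = q /\ fraction_over p).
Proof.
split.
- by split=> //; exists 1, 1; rewrite oner_neq0 !rmorph1 divr1.
- move=> _ _ p p' [-> [P [Q [Q0 ep]]]] [-> [P' [Q' [Q'0 ep']]]]; split=> //.
  exists (P * Q' - P' * Q), (Q * Q'); rewrite mulf_neq0 //; split=> //.
  by rewrite ep ep' subf_div ?tofrac_iota_neq0 // !(rmorphB, rmorphM).
- move=> _ _ p p' [-> [P [Q [Q0 ->]]]] [-> [P' [Q' [Q'0 ->]]]]; split=> //.
  by exists (P * P'), (Q * Q'); rewrite mulf_neq0 // mulf_div !rmorphM.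
- move=> _ p [-> [P [Q [Q0 ep]]]] p0; split=> //; exists Q, P; split.
    by apply: contraNneq p0 => P0; rewrite ep P0 !rmorph0 mul0r.
  by rewrite ep invf_div.
Qed.

End FractionsOverSubring.

Section OverRat.
Variables (R : realType) (n : nat).

Lemma map_ratr_inj : injective (map_mpoly (n := n) (@ratr R)).
Proof.
move=> P Q ePQ; apply/mpolyP => m; apply: (fmorph_inj (@ratr R)).
by rewrite -!mcoeff_map_mpoly ePQ.
Qed.

Lemma over_rat_pm :
  partial_morphism (fun p q : ratfun R n => p = q /\ over_rat p).
Proof. exact: (fraction_over_pm map_ratr_inj). Qed.

Lemma over_ratM (p p' : ratfun R n) :
  over_rat p -> over_rat p' -> over_rat (p * p').
Proof.
move=> pQ p'Q.
by have [] := pmorphM over_rat_pm (conj erefl pQ) (conj erefl p'Q).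
Qed.

Lemma over_rat_const q : over_rat (ratfun_const n (ratr q : R)).
Proof.
exists (mpolyC n q), 1.
by rewrite oner_neq0 map_mpolyC !rmorph1 divr1.
Qed.

Lemma over_rat_var i : over_rat (@var R n i).
Proof.
exists (mpolyX _ (mnm1 i)), 1.
by rewrite oner_neq0 map_mpolyX !rmorph1 divr1.
Qed.

Lemma over_rat_det m (M : 'M[ratfun R n]_m) :
  (forall i j, over_rat (M i j)) -> over_rat (\det M).
Proof.
move=> MQ.
by have [] := pmorph_det over_rat_pm (fun i j => conj erefl (MQ i j)).
Qed.

(** Cramer's rule: the inverse is the adjugate divided by the determinant. *)
Lemma over_rat_invmx m (M : 'M[ratfun R n]_m) :
  (forall i j, over_rat (M i j)) -> forall i j, over_rat (invmx M i j).
Proof.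
move=> MQ i j; rewrite /invmx; case: ifP => [Mu|_]; last exact: MQ.
rewrite !mxE; apply: over_ratM; last first.
  rewrite /cofactor; apply: over_ratM.
    by have [] := pmorph_sign over_rat_pm (j + i).
  by apply: over_rat_det => k l; rewrite !mxE.
have det_neq0 : \det M != 0 by move: Mu; rewrite unitmxE unitfE.
by have [] := pmorphV over_rat_pm (conj erefl (over_rat_det MQ)) det_neq0.
Qed.

End OverRat.

(** * Volumes *)

Section Volumes.
Variables (R : realType) (n d : nat) (x : 'I_n -> 'rV[R]_d).

Lemma det_conform_neq0 m (M : 'M[R]_(m, 1 + d)) : m = d.+1 ->
  (forall u : 'rV_m, u *m M = 0 -> u = 0) ->
  \det (conform_mx (0 : 'M[R]_(1 + d)) M) != 0.
Proof.
move=> em; case: _ / (esym em) in M *; rewrite conform_mx_id => ker0.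
by apply/eqP => /eqP/det0P[u u0 /ker0 u_eq0]; rewrite u_eq0 eqxx in u0.
Qed.

(** A linear dependency u between the rows (1, x_i) of the matrix has
    coefficients summing to 0 and annihilating the points, which affine
    independence forbids. *)
Lemma vol_gt0 sigma : full_simplex x sigma -> 0 < vol x sigma.
Proof.
move=> [card aff]; apply: divr_gt0; last by rewrite ltr0n fact_gt0.
rewrite normr_gt0; apply: det_conform_neq0 => // u.
rewrite mul_mx_row -row_mx0 => /eq_row_mx[u1 ux].
case: (set_0Vmem sigma) => [s0|[i0 is0]]; first by rewrite s0 cards0 in card.
pose c i := u 0 (enum_rank_in is0 i).
have sumE (V : lmodType R) (F : 'I_n -> V) :
    \sum_(i in sigma) c i *: F i = \sum_k u 0 k *: F (enum_val k).
  rewrite big_enum_val; apply: eq_bigr => k _.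
  by rewrite /c enum_valK_in.
apply/rowP => k; rewrite mxE.
rewrite -[LHS](_ : c (enum_val k) = _); last by rewrite /c enum_valK_in.
apply: aff (enum_valP k).
  have := sumE R^o (fun=> 1); under eq_bigr do rewrite [_ *: _]mulr1.
  have := congr1 (fun M : 'M_1 => M 0 0) u1; rewrite !mxE => u10 ->.
  rewrite -[RHS]u10; apply: eq_bigr => l _.
  by rewrite mxE.
rewrite sumE; apply/rowP => l; have := congr1 (fun M : 'rV_d => M 0 l) ux.
rewrite !mxE => <-; rewrite summxE; apply: eq_bigr => a _.
by rewrite !mxE.
Qed.

Lemma vol_rational sigma : rational_configuration x ->
  exists q : rat, vol x sigma = ratr q.
Proof.
move=> ratx.
have [q xq] : exists q : 'I_n -> 'I_d -> rat, forall i k, x i 0 k = ratr (q i k).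
  exists (fun i k => projT1 (cid (ratx i k))) => i k.
  exact: projT2 (cid (ratx i k)).
pose M : 'M[rat]_(#|sigma|, 1 + d) :=
  row_mx (const_mx 1) (\matrix_(k, l) q (enum_val k) l).
exists (`|\det (conform_mx (0 : 'M_(1 + d)) M)| / d`!%:R).
rewrite /vol fmorph_div rmorph_nat /= ratr_norm -det_map_mx map_conform_mx.
rewrite map_row_mx raddf0 map_const_mx rmorph1.
congr (`|\det (conform_mx _ (row_mx _ _))| / _).
by apply/matrixP => k l; rewrite !mxE xq.
Qed.

End Volumes.

(** * Derivatives of the objective *)

Section Derivatives.
Variables (R : realType).

(** Reduction to functions of one real variable, for which a chain rule with
    the exponential is at hand. *)
Lemma is_derive_along_line (V : normedModType R) (f : V -> R) (y v : V) df :
  is_derive (0 : R) 1 (fun h => f (h *: v + y)) df -> is_derive y v f df.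
Proof.
have E : (fun h : R => h^-1 *: ((f \o shift y) (h *: v) - f y)) =
    (fun h => h^-1 *: (((fun h => f (h *: v + y)) \o shift 0) (h *: 1) -
       (f (0 *: v + y)))).
  by apply/funext => h /=; rewrite addr0 scale0r add0r [h *: 1]mulr1.
move=> [d1 d2]; split; first by rewrite /derivable E.
by rewrite /derive E.
Qed.

Lemma is_derive_coord n (y v : 'rV[R]_n) i :
  is_derive y v (fun z : 'rV[R]_n => z 0 i) (v 0 i).
Proof.
apply: is_derive_along_line.
rewrite (_ : (fun h => _) = (fun h => h * v 0 i + y 0 i)); last first.
  by apply/funext => h; rewrite !mxE.
by apply: trigger_derive; rewrite ?scaler0 ?addr0 ?add0r ?[_ *: 1]mulr1.
Qed.

Lemma is_derive_exp_coord n (y v : 'rV[R]_n) i :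
  is_derive y v (fun z : 'rV[R]_n => expR (z 0 i)) (expR (y 0 i) * v 0 i).
Proof.
apply: is_derive_along_line.
rewrite (_ : (fun h => _) = (fun h => expR (h * v 0 i + y 0 i))); last first.
  by apply/funext => h; rewrite !mxE.
apply: trigger_derive.
by rewrite mul0r add0r scaler0 addr0 add0r [_ *: 1]mulr1.
Qed.

Lemma is_derive_bigsum (V : normedModType R) (I : Type) (r : seq I) (P : pred I)
    (f : I -> V -> R) (y v : V) (df : I -> R) :
  (forall a, P a -> is_derive y v (f a) (df a)) ->
  is_derive y v (fun z => \sum_(a <- r | P a) f a z) (\sum_(a <- r | P a) df a).
Proof.
move=> fd; rewrite (_ : (fun z => _) = \sum_(a <- r | P a) f a); last first.
  by apply/funext => z; rewrite fct_sumE.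
elim/big_ind2: _ => [|g dg h dh dg_ dh_|//]; first exact: is_derive_cst.
exact: is_deriveD.
Qed.

(** Logarithmic derivative of a product. *)
Lemma is_derive_prod (V : normedModType R) (I : eqType) (r : seq I)
    (f : I -> V -> R) (y v : V) (df : I -> R) :
  (forall a, a \in r -> f a y != 0) ->
  (forall a, a \in r -> is_derive y v (f a) (df a)) ->
  is_derive y v (fun z => \prod_(a <- r) f a z)
    (\prod_(a <- r) f a y * \sum_(a <- r) df a / f a y).
Proof.
elim: r => [|a r IH] f0 fd.
  rewrite !big_nil mulr0 (_ : (fun _ => _) = cst 1); first exact: is_derive_cst.
  by apply/funext => z; rewrite big_nil.
rewrite (_ : (fun _ => _) = f a * (fun z => \prod_(b <- r) f b z)); last first.
  by apply/funext => z; rewrite big_cons.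
have da := fd a (mem_head a r).
have sub b : b \in r -> b \in a :: r by rewrite inE orbC => ->.
have dr := IH (fun b br => f0 b (sub b br)) (fun b br => fd b (sub b br)).
apply: is_derive_eq.
rewrite !big_cons /= mulrDr addrC; congr (_ + _).
  rewrite [_ *: _]mulrC mulrACA [f a y * _]mulrC mulrACA divff ?mulr1 //.
  by rewrite f0 ?mem_head.
by rewrite [_ *: _]mulrA.
Qed.

Lemma is_derive_inv (V : normedModType R) (f : V -> R) (y v : V) df :
  f y != 0 -> is_derive y v f df ->
  is_derive y v (fun z => (f z)^-1) (- (f y)^-1 * (df / f y)).
Proof.
move=> fy0 [fd fdv]; apply: DeriveDef; first exact: derivableV.
rewrite deriveV // fdv /= [LHS]mulrC mulNr mulrN; congr (- _).
by rewrite expr2 invfM mulrCA mulrC -!mulrA.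
Qed.

Lemma is_derive_objective_term n (c : R) (sigma : {set 'I_n}) (i j : 'I_n)
    (y : 'rV[R]_n) :
  (forall a, a \in (sigma :\ i)%SET -> y 0 i != y 0 a) ->
  is_derive y (delta_mx 0 j : 'rV[R]_n)
    (fun z : 'rV[R]_n => c * expR (z 0 i) /
      \prod_(a in (sigma :\ i)%SET) (z 0 i - z 0 a))
    (c / lagrange_denom (y 0) sigma i *
       ((i == j)%:R - \sum_(a in (sigma :\ i)%SET)
                        ((i == j)%:R - (a == j)%:R) / (y 0 i - y 0 a)) *
     expR (y 0 i)).
Proof.
move=> yi.
have deltaE a : (delta_mx 0 j : 'rV[R]_n) 0 a = (a == j)%:R by rewrite mxE eqxx.
have dexp := is_derive_exp_coord y (delta_mx 0 j) i.
have dprod : is_derive y (delta_mx 0 j : 'rV[R]_n)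
    (fun z : 'rV[R]_n => \prod_(a in (sigma :\ i)%SET) (z 0 i - z 0 a))
    (lagrange_denom (y 0) sigma i *
     \sum_(a in (sigma :\ i)%SET) ((i == j)%:R - (a == j)%:R) / (y 0 i - y 0 a)).
  rewrite -big_enum /= (_ : (fun z => _) = fun z : 'rV[R]_n =>
    \prod_(a <- enum (sigma :\ i)%SET) (z 0 i - z 0 a)); last first.
    by apply/funext => z; rewrite big_enum.
  rewrite /lagrange_denom -big_enum.
  apply: is_derive_prod => a; rewrite mem_enum => /yi; first by rewrite subr_eq0.
  move=> _; rewrite -!deltaE; apply: is_deriveB; exact: is_derive_coord.
have den0 : lagrange_denom (y 0) sigma i != 0.
  by apply/prodf_neq0 => a /yi; rewrite subr_eq0.
have dinv := is_derive_inv den0 dprod.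
have dnum := is_deriveZ c dexp.
apply: is_derive_eq (is_deriveM dnum dinv) _.
rewrite /= deltaE -/(lagrange_denom (y 0) sigma i).
rewrite /GRing.scale /=; set D := \sum_(a in _) _; field.
exact: den0.
Qed.

(** The equations are A e^y = w: the derivative falls either on the factor
    exp(y_i), whence the term [(i == j)%:R], or on the product in the
    denominator, whence the sum of its logarithmic derivatives. *)
Lemma partial_objective n d (x : 'I_n -> 'rV[R]_d) (w : 'I_n -> R) Delta y j :
  objective_domain Delta y ->
  partial (objective x w Delta) j y =
  w j - \sum_i score_matrix Delta (vol x) (y 0) j i * expR (y 0 i).
Proof.
move=> y_dom.
have deltaE a : (delta_mx 0 j : 'rV[R]_n) 0 a = (a == j)%:R by rewrite mxE eqxx.
have dterm sigma i : sigma \in Delta -> i \in sigma ->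
  is_derive y (delta_mx 0 j : 'rV[R]_n)
    (fun z : 'rV[R]_n => vol x sigma * expR (z 0 i) /
      \prod_(a in (sigma :\ i)%SET) (z 0 i - z 0 a))
    (vol x sigma / lagrange_denom (y 0) sigma i *
       ((i == j)%:R - \sum_(a in (sigma :\ i)%SET)
                        ((i == j)%:R - (a == j)%:R) / (y 0 i - y 0 a)) *
     expR (y 0 i)).
  move=> sD isg; apply: is_derive_objective_term => a.
  by rewrite !inE => /andP[ai asg]; apply: y_dom sD _ _ _ _ _; rewrite // eq_sym.
have dsum := is_derive_bigsum (index_enum _) (fun sigma sD =>
  is_derive_bigsum (index_enum _) (fun i => dterm sigma i sD)).
have dlin := is_derive_bigsum (index_enum 'I_n) (P := predT) (fun i _ =>
  is_deriveZ (w i) (is_derive_coord y (delta_mx 0 j) i)).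
have [_] := is_deriveB dlin dsum.
rewrite /partial => ->; congr (_ - _).
  rewrite (bigD1 j) //= deltaE eqxx [_ *: _]mulr1 big1 ?addr0 // => i ij.
  by rewrite deltaE (negPf ij) scaler0.
rewrite [LHS](exchange_big_dep predT) //=; apply: eq_bigr => i _.
rewrite mxE mulr_suml; exact: eq_bigr.
Qed.

End Derivatives.

(** * Values of rational functions at a point *)

Section Values.
Variables (R : realType) (n : nat) (y : 'rV[R]_n).

Lemma ratfun_value_pm : partial_morphism (fun p : ratfun R n => ratfun_value p y).
Proof. exact: (specializes_pm (meval (y 0))). Qed.

Lemma ratfun_value_unique (p : ratfun R n) v v' :
  ratfun_value p y v -> ratfun_value p y v' -> v = v'.
Proof. exact: (@specializes_unique _ _ (meval (y 0))). Qed.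

Lemma ratfun_atP (p : ratfun R n) :
  regular_at p y -> ratfun_value p y (ratfun_at p y).
Proof. exact: xgetPex. Qed.

Lemma ratfun_value_const c : ratfun_value (ratfun_const n c) y c.
Proof.
by have := specializes_tofrac (meval (y 0)) (mpolyC n c); rewrite /= mevalC.
Qed.

Lemma ratfun_value_var i : ratfun_value (@var R n i) y (y 0 i).
Proof.
by have := specializes_tofrac (meval (y 0)) (mpolyX R (mnm1 i)); rewrite /= mevalXU.
Qed.

Lemma ratfun_value_at (p : ratfun R n) v :
  ratfun_value p y v -> ratfun_at p y = v.
Proof.
move=> pv; exact: ratfun_value_unique (ratfun_atP (ex_intro _ v pv)) pv.
Qed.

End Values.

Lemma over_rat_score (R : realType) n d (x : 'I_n -> 'rV[R]_d) Delta :
  rational_configuration x ->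
  forall j i,
    over_rat (score_matrix Delta (ratfun_const n \o vol x) (@var R n) j i).
Proof.
move=> ratx j i.
set A := score_matrix _ _ _.
suff [] : A j i = A j i /\ over_rat (A j i) by [].
apply: (pmorph_score (over_rat_pm R n)).
- move=> sigma _; split=> //=.
  by have [q ->] := vol_rational sigma ratx; apply: over_rat_const.
- by move=> k; split=> //; apply: over_rat_var.
- by move=> sigma _ a b _ _ /var_inj.
Qed.

(** * The critical equations in exponential form *)

Theorem corollary3p5 (R : realType) (n d : nat) (x : 'I_n -> 'rV[R]_d)
    (w : 'I_n -> R) (Delta : {set {set 'I_n}})
    (w_ge0 : forall i, 0 <= w i)
    (w_sum1 : \sum_i w i = 1)
    (Delta_triang : triangulation x Delta)
    (Delta_max : maximal_triangulation Delta)
    (Delta_reg : regular_triangulation x Delta) :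
  exists p : 'I_n -> ratfun R n,
    [/\ can_be_written_as_exp (objective_domain Delta)
          (partial (objective x w Delta)) p,
        rational_configuration x ->
          (forall j, exists q : rat, w j = ratr q) ->
          forall i, over_rat (p i) &
        rational_configuration x ->
          exists q : 'I_n -> 'I_n -> ratfun R n,
            (forall i j, over_rat (q i j)) /\
            forall i, p i = \sum_j ratfun_const n (w j) * q i j].
Proof.
have [simplices _ _] := Delta_triang.
pose A := score_matrix Delta (ratfun_const n \o vol x) (@var R n).
have A_unit : A \in unitmx.
  rewrite unitmxE unitfE; apply: (@det_score_neq0 R n d) => // sigma /simplices.
    exact: vol_gt0.
  by case.
have invA_rat : rational_configuration x -> forall i j, over_rat (invmx A i j).
  by move=> ratx; apply: over_rat_invmx; apply: over_rat_score.
exists (fun i => \sum_j ratfun_const n (w j) * invmx A i j); split.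
- exists (- invmx A); split; first by rewrite -scaleN1r unitmxZ ?unitmx_inv ?unitrN1.
  move=> y y_dom B_reg.
  have vpm := ratfun_value_pm y.
  pose b := \matrix_(i, j) ratfun_at ((- invmx A) i j) y.
  pose a := score_matrix Delta (vol x) (y 0).
  pose e := \col_i expR (y 0 i).
  pose W := \col_j w j.
  have B_b i j : ratfun_value ((- invmx A) i j) y (b i j).
    by rewrite [b i j]mxE; apply: ratfun_atP.
  have A_a i j : ratfun_value (A i j) y (a i j).
    apply: (pmorph_score vpm) => [sigma _|k|sigma sD k l ks ls].
    - exact: ratfun_value_const.
    - exact: ratfun_value_var.
    - by apply: contra_eq; apply: y_dom sD _ _ ks ls.
  (* The identity B *m A = - 1 of rational functions, evaluated at y. *)
  have ba : b *m a = - 1%:M.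
    apply/matrixP => i k; apply: (@ratfun_value_unique _ _ y ((- invmx A *m A) i k)).
      rewrite !mxE; apply: (pmorph_sum vpm) => j _.
      by apply: (pmorphM vpm).
    rewrite mulNmx mulVmx // !mxE; apply: (pmorphN vpm); exact: (pmorph_nat vpm).
  have ab : a *m b = - 1%:M.
    apply: oppr_inj; rewrite -mulmxN opprK; apply: mulmx1C.
    by rewrite mulNmx ba opprK.
  have F_E j : partial (objective x w Delta) j y = (W - a *m e) j 0.
    rewrite partial_objective // !mxE; congr (_ - _).
    by apply: eq_bigr => i _; rewrite !mxE.
  have p_value i : ratfun_value (\sum_j ratfun_const n (w j) * invmx A i j) y
      ((- (b *m W)) i 0).
    rewrite -mulNmx [X in ratfun_value _ y X]mxE; apply: (pmorph_sum vpm) => j _.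
    rewrite [W j 0]mxE mulrC; apply: (pmorphM vpm); last exact: ratfun_value_const.
    rewrite [(- b) i j]mxE -[invmx A i j]opprK; apply: (pmorphN vpm).
    by have := B_b i j; rewrite [(- invmx A) i j]mxE.
  have e_sub_p : e + b *m W = b *m (W - a *m e).
    by rewrite mulmxBr mulmxA ba mulNmx mul1mx opprK addrC.
  have p_at i := ratfun_value_at (p_value i).
  split.
  + by move=> i; exists ((- (b *m W)) i 0).
  + move=> i; rewrite p_at; have := congr1 (fun M : 'cV_n => M i 0) e_sub_p.
    rewrite [LHS]mxE [RHS]mxE [e i 0]mxE [in X in _ -> X]mxE opprK => ->.
    by apply: eq_bigr => j _; rewrite F_E mxE.
  + have F0E : (forall j, partial (objective x w Delta) j y = 0) <-> W - a *m e = 0.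
      split=> [F0|F0 j]; last by rewrite F_E F0 mxE.
      by apply/colP => j; rewrite -F_E F0 mxE.
    have pE : (forall i, expR (y 0 i) =
        ratfun_at (\sum_j ratfun_const n (w j) * invmx A i j) y) <-> e + b *m W = 0.
      split=> [ep|ep i]; last first.
        by rewrite p_at -(addr0_eq ep) opprK mxE.
      apply/eqP; rewrite addr_eq0; apply/eqP/colP => i.
      by rewrite -p_at -ep mxE.
    rewrite F0E pE e_sub_p; split=> [->|bF0]; first by rewrite mulmx0.
    by rewrite -[LHS]mul1mx -[1%:M]opprK -ab mulNmx -mulmxA bF0 mulmx0 oppr0.
- move=> ratx ratw i.
  have summand_rat j : over_rat (ratfun_const n (w j) * invmx A i j).
    apply: over_ratM; last exact: invA_rat.
    by have [q ->] := ratw j; apply: over_rat_const.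
  by have [] := pmorph_sum (over_rat_pm R n) (index_enum _) (P := predT)
    (fun j _ => conj erefl (summand_rat j)).
- by move=> ratx; exists (invmx A); split=> //; apply: invA_rat.
Qed.
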